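(* Let $\Lambda$ be a left FPE ring. Then the natural transformation $\kappa:\mathfrak{s}\to\mathrm{Hom}_\Lambda(\mathfrak{q}({}_\Lambda\Lambda),\_)$ is the zeroth right derived functor of $\mathfrak{s}$ on right $\Lambda$-modules (that is, $R^0\mathfrak{s}\simeq\mathrm{Hom}_\Lambda(\mathfrak{q}({}_\Lambda\Lambda),\_)$, with $\kappa$ corresponding to the canonical transformation $\mathfrak{s}\to R^0\mathfrak{s}$). Consequently, \[R^i\mathfrak{s}\simeq\mathrm{Ext}^i_\Lambda(\mathfrak{q}({}_\Lambda\Lambda),\_)\] for all integers $i$.
   Context: $\Lambda$ is left FPE if the injective envelope $I$ of the left module ${}_\Lambda\Lambda$ is finitely presented. Let $\iota:\Lambda\to I$ be this injective envelope. For a right $\Lambda$-module $M$, the injective torsion is $\mathfrak{s}(M):=\ker(1\otimes\iota:M\otimes_\Lambda\Lambda\to M\otimes_\Lambda I)\subseteq M$. For a left $\Lambda$-module $C$, the cotorsion module $\mathfrak{q}(C)$ is the quotient of $\mathrm{Hom}_\Lambda(\Lambda,C)\cong C$ by the submodule of maps $\Lambda\to C$ factoring through injective left modules. In particular $\mathfrak{q}({}_\Lambda\Lambda)=\Lambda/Tr(\mathscr{I},{}_\Lambda\Lambda)$, where $Tr(\mathscr{I},{}_\Lambda\Lambda)$ is the trace in ${}_\Lambda\Lambda$ of the class of injective left modules; it is a two-sided ideal, so $\mathfrak{q}({}_\Lambda\Lambda)$ is a $\Lambda$-$\Lambda$-bimodule, and here it is regarded as a right $\Lambda$-module. The transformation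 $\kappa$ is the monomorphism induced by the canonical isomorphism $M\otimes_\Lambda\Lambda\cong\mathrm{Hom}_\Lambda(\Lambda_\Lambda,M)$: explicitly, $\kappa_M(m)$ is the map sending the class of $\lambda\in\Lambda$ to $m\lambda$, for $m\in\mathfrak{s}(M)$. For an additive functor $F$, $R^iF$ denotes the $i$-th cohomology of $F$ applied to an injective resolution (with $R^iF=0$ for $i<0$), and $F\to R^0F$ is the canonical transformation ($F$ is not assumed left exact). *)

(* Defs.v *)
From HB Require Import structures.
From mathcomp Require Import all_boot all_order all_algebra.
From mathcomp Require Import boolp.
From mathcomp Require Import freeg.

Set Implicit Arguments.
Unset Strict Implicit.
Unset Printing Implicit Defensive.

Import GRing.Theory.
Local Open Scope ring_scope.
Local Open Scope quotient_scope.

(* Left L-modules are [lmodType L]; right L-modules are left modules over the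
   converse ring, m * a being [(a : L^c) *: m].  The regular left module is
   [L^o] and the regular right module is [(L^c)^o]. *)
Notation rmodType L := (lmodType L^c) (only parsing).

Record subgroup (V : zmodType) (S : zmodClosed V) :=
  Subgroup { sg_val : V; sg_valP : sg_val \in S }.

Section Subgroups.
Variables (V : zmodType) (S : zmodClosed V).

HB.instance Definition _ := [isSub for @sg_val V S].
HB.instance Definition _ := [Choice of subgroup S by <:].
HB.instance Definition _ := GRing.SubChoice_isSubZmodule.Build V _
  (subgroup S) (conj (rpred0 S) (@rpredB V S)).

End Subgroups.

Definition zmod_closed_pack (V : zmodType) (S : V -> bool)
    (clS : zmod_closed (S : {pred V})) : zmodClosed V :=
  HB.pack S (GRing.isZmodClosed.Build V S clS).

Section SubgroupMap.
Variables (V W : zmodType) (S : zmodClosed V) (T : zmodClosed W).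
Variables (f : {additive V -> W}) (fST : forall x, x \in S -> f x \in T).

Definition sg_map (x : subgroup S) : subgroup T := Subgroup (fST (sg_valP x)).

Fact sg_map_zmod_morphism : zmod_morphism sg_map.
Proof. by move=> x y; apply: val_inj; rewrite /= !raddfB. Qed.

HB.instance Definition _ :=
  GRing.isZmodMorphism.Build _ _ sg_map sg_map_zmod_morphism.

End SubgroupMap.

Section QuotientMap.
Variables (V W : zmodType) (S : zmodClosed V).

Lemma pi_quot_eq0 (x : V) :
  (\pi_(Quotient.quot S) x == 0) = (x \in S).
Proof. by rewrite -[0](raddf0 \pi_(Quotient.quot S)) -Quotient.idealrBE subr0. Qed.

Section Lift.
Variable f : {additive V -> W}.

Definition quot_lift of (forall x, x \in S -> f x = 0) :=
  fun u : Quotient.quot S => f (repr u).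

Hypothesis fS : forall x, x \in S -> f x = 0.

Lemma quot_lift_pi x : quot_lift fS (\pi x) = f x.
Proof.
apply/eqP; rewrite -subr_eq0 -raddfB; apply/eqP/fS.
by rewrite Quotient.idealrBE reprK.
Qed.

Fact quot_lift_zmod_morphism : zmod_morphism (quot_lift fS).
Proof.
move=> x y; rewrite -[x]reprK -[y]reprK -raddfB !quot_lift_pi.
exact: raddfB.
Qed.

HB.instance Definition _ :=
  GRing.isZmodMorphism.Build _ _ (quot_lift fS) quot_lift_zmod_morphism.

End Lift.
End QuotientMap.

Section QuotientFunctoriality.
Variables (V W : zmodType) (S : zmodClosed V) (T : zmodClosed W).
Variables (f : {additive V -> W}) (fST : forall x, x \in S -> f x \in T).

Fact quot_map_subproof x :
  x \in S -> (\pi_(Quotient.quot T) \o f) x = 0.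
Proof. by move=> /fST fxT; apply/eqP; rewrite /= pi_quot_eq0. Qed.

Definition quot_map : {additive Quotient.quot S -> Quotient.quot T} :=
  quot_lift quot_map_subproof.

Lemma quot_map_pi x : quot_map (\pi x) = \pi_(Quotient.quot T) (f x).
Proof. exact: quot_lift_pi. Qed.

End QuotientFunctoriality.

Record submodule (R : pzRingType) (V : lmodType R) := Submodule {
  sm_pred : V -> bool;
  sm_closed : submod_closed (sm_pred : {pred V}) }.

Definition sm_subgroup (R : pzRingType) (V : lmodType R) (S : submodule V) :
  zmodClosed V := zmod_closed_pack (GRing.submod_closedB (sm_closed S)).

Definition quot_mod (R : pzRingType) (V : lmodType R) (S : submodule V) :=
  Quotient.quot (sm_subgroup S).

Section QuotientModule.
Variables (R : pzRingType) (V : lmodType R) (S : submodule V).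

HB.instance Definition _ := GRing.Zmodule.on (quot_mod S).

Definition pi_mod (x : V) : quot_mod S := \pi x.

Lemma pi_mod_eq0 x : (pi_mod x == 0) = (x \in sm_pred S).
Proof. exact: pi_quot_eq0. Qed.

Lemma pi_modB : {morph pi_mod : x y / x - y}.
Proof. exact: raddfB. Qed.

Lemma pi_modD : {morph pi_mod : x y / x + y}.
Proof. exact: raddfD. Qed.

Lemma pi_mod_surj (u : quot_mod S) : exists x, u = pi_mod x.
Proof. by exists (repr u); rewrite /pi_mod reprK. Qed.

Definition quot_scale (a : R) (u : quot_mod S) : quot_mod S :=
  pi_mod (a *: (repr u : V)).

Lemma quot_scale_pi a x : quot_scale a (pi_mod x) = pi_mod (a *: x).
Proof.
apply/eqP; rewrite -subr_eq0 -pi_modB pi_mod_eq0 -scalerBr.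
have [S0 Slin] := sm_closed S; rewrite -[_ *: _]addr0 Slin //.
by rewrite -pi_mod_eq0 pi_modB /pi_mod reprK subrr.
Qed.

Fact quot_scalerA a b u : quot_scale a (quot_scale b u) = quot_scale (a * b) u.
Proof. by have [x ->] := pi_mod_surj u; rewrite !quot_scale_pi scalerA. Qed.

Fact quot_scale1r : left_id 1 quot_scale.
Proof. by move=> u; have [x ->] := pi_mod_surj u; rewrite !quot_scale_pi scale1r. Qed.

Fact quot_scalerDr : right_distributive quot_scale +%R.
Proof.
move=> a u v; have [x ->] := pi_mod_surj u; have [y ->] := pi_mod_surj v.
by rewrite -pi_modD !quot_scale_pi scalerDr pi_modD.
Qed.

Fact quot_scalerDl u : {morph quot_scale^~ u : a b / a + b}.
Proof.
by move=> a b; have [x ->] := pi_mod_surj u;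
   rewrite !quot_scale_pi scalerDl pi_modD.
Qed.

HB.instance Definition _ := GRing.Zmodule_isLmodule.Build R (quot_mod S)
  quot_scalerA quot_scale1r quot_scalerDr quot_scalerDl.

Fact pi_mod_linear : linear pi_mod.
Proof. by move=> a x y; rewrite pi_modD -quot_scale_pi. Qed.

HB.instance Definition _ := GRing.isLinear.Build R V (quot_mod S) _ pi_mod
  pi_mod_linear.

Section LinearLift.
Variables (W : lmodType R) (f : {linear V -> W}).

Definition quot_mod_lift of (forall x, x \in sm_pred S -> f x = 0) :=
  fun u : quot_mod S => f (repr u).

Hypothesis fS : forall x, x \in sm_pred S -> f x = 0.

Lemma quot_mod_lift_pi x : quot_mod_lift fS (pi_mod x) = f x.
Proof. exact: quot_lift_pi. Qed.

Fact quot_mod_lift_linear : linear (quot_mod_lift fS).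
Proof.
move=> a u v; have [x ->] := pi_mod_surj u; have [y ->] := pi_mod_surj v.
by rewrite -linearP !quot_mod_lift_pi linearP.
Qed.

HB.instance Definition _ := GRing.isLinear.Build R (quot_mod S) W _
  (quot_mod_lift fS) quot_mod_lift_linear.

End LinearLift.
End QuotientModule.

Definition injective_module (R : pzRingType) (E : lmodType R) : Prop :=
  forall (A B : lmodType R) (i : {linear A -> B}) (f : {linear A -> E}),
    injective i -> exists g : {linear B -> E}, forall x, g (i x) = f x.

Definition essential (R : pzRingType) (M E : lmodType R)
    (i : {linear M -> E}) : Prop :=
  forall S : submodule E, (exists2 x, x \in sm_pred S & x != 0) ->
    exists2 m, i m \in sm_pred S & i m != 0.

Definition injective_envelope (R : pzRingType) (M E : lmodType R)
    (i : {linear M -> E}) : Prop :=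
  [/\ injective_module E, injective i & essential i].

Definition finitely_presented (R : pzRingType) (M : lmodType R) : Prop :=
  exists (n m : nat) (p : {linear 'rV[R]_n -> M})
         (k : {linear 'rV[R]_m -> 'rV[R]_n}),
    (forall x, exists u, p u = x) /\
    (forall u, p u = 0 <-> exists v, k v = u).

(* As injective envelopes are unique up to isomorphism, it does not matter
   whether one or every envelope is required to be finitely presented. *)
Definition left_FPE (L : pzRingType) : Prop :=
  exists (I : lmodType L) (iota : {linear L^o -> I}),
    injective_envelope iota /\ finitely_presented I.

Section Tensor.
Variables (L : pzRingType) (M : rmodType L) (N : lmodType L).

Inductive tensor_relation : {freeg (M * N) / int} -> Prop :=
| TensorRel0 : tensor_relation 0
| TensorRelB x y :
    tensor_relation x -> tensor_relation y -> tensor_relation (x - y)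
| TensorRelDl m m' n :
    tensor_relation (<< (m + m', n) >> - << (m, n) >> - << (m', n) >>)
| TensorRelDr m n n' :
    tensor_relation (<< (m, n + n') >> - << (m, n) >> - << (m, n') >>)
| TensorRelZ m (a : L) (n : N) :
    tensor_relation (<< ((a : L^c) *: m, n) >> - << (m, a *: n) >>).

Definition tensor_relator : {freeg (M * N) / int} -> bool :=
  fun x => `[< tensor_relation x >].

Fact tensor_relator_closed : zmod_closed (tensor_relator : {pred _}).
Proof.
split=> [|x y /asboolP xR /asboolP yR]; apply/asboolP; first exact: TensorRel0.
exact: TensorRelB.
Qed.

Definition tensor := Quotient.quot (zmod_closed_pack tensor_relator_closed).

HB.instance Definition _ := GRing.Zmodule.on tensor.

Definition tens (m : M) (n : N) : tensor := \pi << (m, n) >>.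

Definition balanced (A : zmodType) (b : M -> N -> A) : Prop :=
  [/\ forall m m' n, b (m + m') n = b m n + b m' n,
      forall m n n', b m (n + n') = b m n + b m n'
    & forall m (a : L) n, b ((a : L^c) *: m) n = b m (a *: n)].

Lemma tens_balanced : balanced tens.
Proof.
have tensE x y : tensor_relation (x - y) -> \pi_tensor x = \pi y.
  move=> xyR; apply/eqP; rewrite -Quotient.idealrBE; exact/asboolP.
split=> [m m' n|m n n'|m a n]; last exact/tensE/TensorRelZ.
  by rewrite /tens -raddfD; apply: tensE; rewrite opprD addrA; apply: TensorRelDl.
by rewrite /tens -raddfD; apply: tensE; rewrite opprD addrA; apply: TensorRelDr.
Qed.

Section TensorLift.
Variables (A : zmodType) (b : M -> N -> A).

(* [zmodule A] is A seen as a Z-module *)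
Definition free_lift (x : {freeg (M * N) / int}) : A :=
  fglift (fun mn : M * N => b mn.1 mn.2 : zmodule A) x.

Fact free_lift_zmod_morphism : zmod_morphism free_lift.
Proof.
move=> x y; rewrite /free_lift; exact: (@lift_is_additive int _ (zmodule A)).
Qed.

HB.instance Definition _ :=
  GRing.isZmodMorphism.Build _ _ free_lift free_lift_zmod_morphism.

Lemma free_liftU m n : free_lift << (m, n) >> = b m n.
Proof. by rewrite /free_lift liftU. Qed.

Hypothesis bP : balanced b.

Fact tensor_lift_subproof x :
  x \in zmod_closed_pack tensor_relator_closed -> free_lift x = 0.
Proof.
have [bDl bDr bZ] := bP; move=> /asboolP; elim=> {x}.
- exact: raddf0.
- by move=> x y _ x0 _ y0; rewrite raddfB /= x0 y0 subrr.
- by move=> m m' n; rewrite !raddfB /= !free_liftU bDl -addrA -opprD subrr.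
- by move=> m n n'; rewrite !raddfB /= !free_liftU bDr -addrA -opprD subrr.
- by move=> m a n; rewrite !raddfB /= !free_liftU bZ subrr.
Qed.

Definition tensor_lift : {additive tensor -> A} :=
  quot_lift tensor_lift_subproof.

Lemma tensor_lift_tens m n : tensor_lift (tens m n) = b m n.
Proof. exact: etrans (quot_lift_pi _ _) (free_liftU m n). Qed.

End TensorLift.
End Tensor.

Section TensorMap.
Variables (L : pzRingType) (M M' : rmodType L) (N N' : lmodType L).
Variables (f : {linear M -> M'}) (g : {linear N -> N'}).

Fact tensor_map_balanced : balanced (fun m n => tens (f m) (g n)).
Proof.
have [tDl tDr tZ] := tens_balanced M' N'.
by split=> [m m' n|m n n'|m a n]; rewrite ?linearD ?linearZ_LR ?tDl ?tDr ?tZ.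
Qed.

Definition tensor_map : {additive tensor M N -> tensor M' N'} :=
  tensor_lift tensor_map_balanced.

Lemma tensor_map_tens m n : tensor_map (tens m n) = tens (f m) (g n).
Proof. exact: tensor_lift_tens. Qed.

End TensorMap.

Record add_functor (R : pzRingType) := AddFunctor {
  fobj :> lmodType R -> zmodType;
  fmap : forall M N : lmodType R, {linear M -> N} -> {additive fobj M -> fobj N};
  fmap_ext : forall (M N : lmodType R) (f g : {linear M -> N}),
    f =1 g -> fmap f =1 fmap g;
  fmap_id : forall M : lmodType R, fmap (idfun : {linear M -> M}) =1 id;
  fmap_comp : forall (M N P : lmodType R) (g : {linear N -> P})
      (f : {linear M -> N}),
    fmap (g \o f : {linear M -> P}) =1 fmap g \o fmap f;
  fmapD : forall (M N : lmodType R) (f g : {linear M -> N}),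
    fmap (f \+ g : {linear M -> N}) =1 fmap f \+ fmap g }.
Arguments fmap {R} a {M N} f.
Arguments fmap_ext {R} a {M N} f g.
Arguments fmap_id {R} a M.
Arguments fmap_comp {R} a {M N P} g f.
Arguments fmapD {R} a {M N} f g.

Record nat_trans (R : pzRingType) (F G : add_functor R) := NatTrans {
  ncomp :> forall M : lmodType R, {additive F M -> G M};
  ncomp_nat : forall (M N : lmodType R) (f : {linear M -> N}) (x : F M),
    ncomp N (fmap F f x) = fmap G f (ncomp M x) }.

Definition is_nat_iso (R : pzRingType) (F G : add_functor R)
    (t : nat_trans F G) : Prop :=
  forall M : lmodType R, bijective (t M).

Section AddFunctorTheory.
Variables (R : pzRingType) (F : add_functor R) (M N : lmodType R).

Lemma fmap0 (f : {linear M -> N}) :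
  (forall x, f x = 0) -> forall x, fmap F f x = 0.
Proof.
move=> f0 x; have := fmapD F f f x; rewrite /=.
rewrite (fmap_ext F _ f) => [e|y /=]; last by rewrite f0 addr0.
by apply: (addrI (fmap F f x)); rewrite -e addr0.
Qed.

Lemma fmapB (f g h : {linear M -> N}) : (forall x, h x = f x - g x) ->
  forall x, fmap F h x = fmap F f x - fmap F g x.
Proof.
move=> hE x; apply: (addIr (fmap F g x)); rewrite subrK.
have /= <- := fmapD F h g x; apply: fmap_ext => y /=.
by rewrite hE subrK.
Qed.

End AddFunctorTheory.

Definition zero_functor (R : pzRingType) : add_functor R.
Proof.
by exists (fun=> 'rV[int]_0)
  (fun M N f => \0 : {additive 'rV[int]_0 -> 'rV[int]_0});
  move=> * x; apply/rowP=> -[].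
Defined.

Lemma linear_ext (R : pzRingType) (M N : lmodType R) (f g : {linear M -> N}) :
  f =1 g -> f = g.
Proof.
case: f g => f cf [g cg] /= /funext fg; rewrite /= in fg; subst g.
congr GRing.Linear.Pack; case: cf cg => [[a] [b]] [[a'] [b']].
congr GRing.Linear.Class;
  [congr Algebra.isNmodMorphism.Axioms_ | congr GRing.isScalable.Axioms_];
  exact: Prop_irrelevance.
Qed.

Definition linhom (R : pzRingType) (Q M : lmodType R) := {linear Q -> M}.

Section LinearHom.
Variables (R : pzRingType) (Q M : lmodType R).
Implicit Types f g h : linhom Q M.

HB.instance Definition _ := gen_eqMixin (linhom Q M).
HB.instance Definition _ := gen_choiceMixin (linhom Q M).

Definition linhom_fun f : {linear Q -> M} := f.
Coercion linhom_fun : linhom >-> GRing.Linear.type.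

Let addh f g : linhom Q M := (f \+ g : {linear Q -> M}).
Let opph f : linhom Q M := (\- f : {linear Q -> M}).
Let zeroh : linhom Q M := (\0 : {linear Q -> M}).

Fact linhom_addA : associative addh.
Proof. by move=> f g h; apply: linear_ext => x /=; rewrite addrA. Qed.

Fact linhom_addC : commutative addh.
Proof. by move=> f g; apply: linear_ext => x /=; rewrite addrC. Qed.

Fact linhom_add0 : left_id zeroh addh.
Proof. by move=> f; apply: linear_ext => x /=; rewrite add0r. Qed.

Fact linhom_addN : left_inverse zeroh opph addh.
Proof. by move=> f; apply: linear_ext => x /=; rewrite addNr. Qed.

HB.instance Definition _ := GRing.isZmodule.Build (linhom Q M)
  linhom_addA linhom_addC linhom_add0 linhom_addN.

Lemma linhomDE f g x : (f + g) x = f x + g x.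
Proof. by []. Qed.

Lemma linhomBE f g x : (f - g) x = f x - g x.
Proof. by []. Qed.

End LinearHom.

Section HomFunctor.
Variables (R : pzRingType) (Q : lmodType R).

Definition linhom_map (M N : lmodType R) (f : {linear M -> N})
  (h : linhom Q M) : linhom Q N := (f \o h : {linear Q -> N}).

Fact linhom_map_zmod_morphism (M N : lmodType R) (f : {linear M -> N}) :
  zmod_morphism (linhom_map f).
Proof. by move=> g h; apply: linear_ext => x /=; rewrite linearB. Qed.

HB.instance Definition _ (M N : lmodType R) (f : {linear M -> N}) :=
  GRing.isZmodMorphism.Build _ _ (linhom_map f) (linhom_map_zmod_morphism f).

Definition hom_functor : add_functor R.
Proof.
exists (linhom Q) (fun M N f => linhom_map f : {additive linhom Q M -> linhom Q N}).
- by move=> M N f g fg h; apply: linear_ext => x /=; apply: fg.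
- by move=> M h; apply: linear_ext.
- by move=> M N P g f h; apply: linear_ext.
- by move=> M N f g h; apply: linear_ext.
Defined.

End HomFunctor.

Section InjectiveTorsion.
Variables (L : pzRingType) (I : lmodType L) (iota : {linear L^o -> I}).

(* s(M) is the kernel of M (x) L -> M (x) I, seen in M along m |-> m (x) 1 *)
Definition torsion_pred (M : rmodType L) : M -> bool :=
  fun m => tensor_map (idfun : {linear M -> M}) iota (tens m (1 : L^o)) == 0.

Fact torsion_closed (M : rmodType L) :
  zmod_closed (torsion_pred (M := M) : {pred M}).
Proof.
have [tDl _ _] := tens_balanced M I.
have t0 : tens 0 (iota 1) = 0 :> tensor M I.
  by apply: (addrI (tens 0 (iota 1))); rewrite -tDl !addr0.
split=> [|x y]; rewrite !unfold_in /torsion_pred !tensor_map_tens /= ?t0 //.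
move=> /eqP x0 /eqP y0; rewrite -[eqbLHS]addr0 -{1}y0 -tDl subrK.
by rewrite x0.
Qed.

Lemma torsionE (M : rmodType L) (m : M) :
  (m \in zmod_closed_pack (@torsion_closed M)) = (tens m (iota 1) == 0).
Proof. by rewrite -[LHS]/(torsion_pred m) /torsion_pred tensor_map_tens. Qed.

Definition torsion (M : rmodType L) :=
  subgroup (zmod_closed_pack (@torsion_closed M)).

HB.instance Definition _ (M : rmodType L) := GRing.Zmodule.on (torsion M).

Fact torsion_map_subproof (M N : rmodType L) (f : {linear M -> N}) x :
  x \in zmod_closed_pack (@torsion_closed M) ->
  f x \in zmod_closed_pack (@torsion_closed N).
Proof.
rewrite !torsionE => /eqP x0.
have := tensor_map_tens f (idfun : {linear I -> I}) x (iota 1).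
by rewrite x0 raddf0 /= => <-.
Qed.

Definition torsion_functor : add_functor L^c.
Proof.
exists torsion (fun M N f => sg_map (torsion_map_subproof f)
  : {additive torsion M -> torsion N}).
- by move=> M N f g fg x; apply: val_inj => /=.
- by move=> M x; apply: val_inj.
- by move=> M N P g f x; apply: val_inj.
- by move=> M N f g x; apply: val_inj.
Defined.

End InjectiveTorsion.

Section Cotorsion.
Variable L : pzRingType.

(* Hom(L, C) is identified with C: the element c stands for the map
   a |-> a *: c, and the condition is that this map factors through an
   injective module. *)
Definition factors_injective (C : lmodType L) (c : C) : Prop :=
  exists (J : lmodType L) (f : {linear L^o -> J}) (g : {linear J -> C}),
    injective_module J /\ forall a : L, g (f a) = a *: c.

Definition cotorsion_pred : (L^c)^o -> bool :=
  fun c => `[< factors_injective (c : L^o) >].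

Lemma injective_zero : injective_module ('rV[L]_0).
Proof.
move=> A B i f _; exists (\0 : {linear B -> 'rV[L]_0}) => x.
by apply/rowP => -[].
Qed.

Lemma injective_prod (J K : lmodType L) :
  injective_module J -> injective_module K -> injective_module (J * K)%type.
Proof.
move=> Jinj Kinj A B i f iinj.
have [g gE] := Jinj A B i (fst \o f : {linear A -> J}) iinj.
have [h hE] := Kinj A B i (snd \o f : {linear A -> K}) iinj.
pose gh (x : B) : J * K := (g x, h x).
have ghL : linear gh.
  by move=> a x y; rewrite /gh !linearP.
pose ghM := GRing.isLinear.Build _ _ _ _ gh ghL.
exists (HB.pack_for {linear B -> (J * K)%type} gh ghM) => x /=.
by rewrite /gh gE hE /=; case: (f x).
Qed.

Fact cotorsion_closed : submod_closed (cotorsion_pred : {pred _}).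
Proof.
split=> [|r x y /asboolP[J [f [g [Jinj fg]]]] /asboolP[K [h [k [Kinj hk]]]]].
  apply/asboolP; exists 'rV[L]_0, \0, \0; split; first exact: injective_zero.
  by move=> a; rewrite /= scaler0.
apply/asboolP; exists (J * K)%type.
pose fh (a : L^o) : J * K := (f a, h a).
have fhL : linear fh by move=> a u v; rewrite /fh !linearP.
pose gk (u : J * K) : L^o := (g u.1 : L) * r + k u.2.
have gkL : linear gk.
  move=> a u v; rewrite /gk !linearP.
  change ((a * (g u.1 : L) + (g v.1 : L)) * (r : L)
          + (a * (k u.2 : L) + (k v.2 : L))
        = a * ((g u.1 : L) * (r : L) + (k u.2 : L))
          + ((g v.1 : L) * (r : L) + (k v.2 : L))).
  by rewrite mulrDl mulrDr mulrA addrACA.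
exists (HB.pack_for {linear L^o -> (J * K)%type} fh
  (GRing.isLinear.Build _ _ _ _ fh fhL)).
exists (HB.pack_for {linear (J * K)%type -> L^o} gk
  (GRing.isLinear.Build _ _ _ _ gk gkL)).
split; first exact: injective_prod.
move=> a; rewrite /= /gk /fh /= fg hk.
change (a * (x : L) * (r : L) + a * (y : L)
      = a * ((x : L) * (r : L) + (y : L))).
by rewrite mulrDr mulrA.
Qed.

(* q(L), with the right module structure induced by right multiplication *)
Definition cotorsion : rmodType L := quot_mod (Submodule cotorsion_closed).

End Cotorsion.

Section Kappa.
Variables (L : pzRingType) (I : lmodType L) (iota : {linear L^o -> I}).
Hypothesis iota_env : injective_envelope iota.
Variable M : rmodType L.

Definition act_hom (m : M) : (L^c)^o -> M := fun a => (a : L^c) *: m.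

Fact act_hom_linear m : linear (act_hom m).
Proof. by move=> a b c; rewrite /act_hom scalerDl -scalerA. Qed.

HB.instance Definition _ m :=
  GRing.isLinear.Build _ _ _ _ (act_hom m) (act_hom_linear m).

Fact kappa_subproof (m : torsion iota M) c :
  c \in sm_pred (Submodule (@cotorsion_closed L)) -> act_hom (val m) c = 0.
Proof.
have [_ iota_inj _] := iota_env; move=> /asboolP[J [f [g [Jinj fg]]]].
have [f' f'E] := Jinj _ _ iota f iota_inj.
have bP : balanced (fun (x : M) (i : I) => ((g (f' i) : L) : L^c) *: x).
  split=> [x y i|x i j|x a i]; first by rewrite scalerDr.
    by rewrite !linearD scalerDl.
  by rewrite scalerA !linearZ.
have := sg_valP m; rewrite torsionE => /eqP m0.
have := tensor_lift_tens bP (val m) (iota 1).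
by rewrite m0 raddf0 f'E fg /= [1 *: _]scale1r => /esym.
Qed.

Definition kappa_fun (m : torsion iota M) : linhom (cotorsion L) M :=
  (quot_mod_lift (kappa_subproof m) : {linear _ -> _}).

Lemma kappa_funE m (a : (L^c)^o) :
  kappa_fun m (pi_mod _ a) = (a : L^c) *: val m.
Proof. exact: (quot_mod_lift_pi (kappa_subproof m)). Qed.

Fact kappa_zmod_morphism : zmod_morphism kappa_fun.
Proof.
move=> x y; apply: linear_ext => u; have [a ->] := pi_mod_surj u.
by rewrite linhomBE !kappa_funE -scalerBr.
Qed.

HB.instance Definition _ :=
  GRing.isZmodMorphism.Build _ _ kappa_fun kappa_zmod_morphism.

End Kappa.

Definition kappa (L : pzRingType) (I : lmodType L) (iota : {linear L^o -> I})
    (iota_env : injective_envelope iota) :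
  nat_trans (torsion_functor iota) (hom_functor (cotorsion L)).
Proof.
exists (fun M => kappa_fun iota_env (M := M)
  : {additive torsion iota M -> linhom (cotorsion L) M}).
move=> M N f x; apply: linear_ext => u; have [a ->] := pi_mod_surj u.
transitivity (f ((a : L^c) *: val x)); first by rewrite linearZ; apply: kappa_funE.
by apply: (congr1 f); apply/esym/kappa_funE.
Defined.

Record injective_resolution (R : pzRingType) (M : lmodType R) :=
  InjectiveResolution {
  ires_obj :> nat -> lmodType R;
  ires_d : forall n, {linear ires_obj n -> ires_obj n.+1};
  ires_aug : {linear M -> ires_obj 0};
  ires_injective : forall n, injective_module (ires_obj n);
  ires_aug_inj : injective ires_aug;
  ires_exact0 : forall x : ires_obj 0,
    ires_d 0 x = 0 <-> exists m, ires_aug m = x;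
  ires_exactS : forall n (x : ires_obj n.+1),
    ires_d n.+1 x = 0 <-> exists y, ires_d n y = x }.
Arguments ires_d {R M} i n : rename.
Arguments ires_aug {R M} i : rename.

Definition chain_lift (R : pzRingType) (M N : lmodType R) (f : {linear M -> N})
    (E : injective_resolution M) (E' : injective_resolution N)
    (phi : forall n, {linear E n -> E' n}) : Prop :=
  (forall m, phi 0 (ires_aug E m) = ires_aug E' (f m)) /\
  (forall n x, phi n.+1 (ires_d E n x) = ires_d E' n (phi n x)).

Section Comparison.
Variable R : pzRingType.

Fact ker_closed (A B : lmodType R) (v : {linear A -> B}) :
  submod_closed ((fun x => v x == 0) : {pred A}).
Proof.
split=> [|a x y]; rewrite !unfold_in ?linear0 // => /eqP x0 /eqP y0.
by rewrite linearP x0 y0 scaler0 addr0.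
Qed.

Lemma injective_extend (A B J : lmodType R) (v : {linear A -> B})
    (h : {linear A -> J}) :
  injective_module J -> (forall a, v a = 0 -> h a = 0) ->
  exists k : {linear B -> J}, forall a, k (v a) = h a.
Proof.
move=> Jinj vh; pose K := Submodule (ker_closed v).
have vK x : x \in sm_pred K -> v x = 0 by move=> /eqP.
have hK x : x \in sm_pred K -> h x = 0 by move=> /eqP/vh.
have vinj : injective (quot_mod_lift vK).
  move=> u w; have [x ->] := pi_mod_surj u; have [y ->] := pi_mod_surj w.
  rewrite !quot_mod_lift_pi => vxy; apply/eqP.
  by rewrite -subr_eq0 -linearB pi_mod_eq0 unfold_in /= linearB vxy subrr.
have [k kE] := Jinj _ _ (quot_mod_lift vK : {linear _ -> _})
  (quot_mod_lift hK : {linear _ -> _}) vinj.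
exists k => a; have := kE (pi_mod K a).
by rewrite /= !quot_mod_lift_pi.
Qed.

Lemma dependent_choice (T : nat -> Type) (r : forall n, T n -> T n.+1 -> Prop) :
  (forall n x, exists y, r n x y) ->
  forall x0 : T 0, exists s : forall n, T n,
    s 0 = x0 /\ forall n, r n (s n) (s n.+1).
Proof.
move=> rT x0.
exists (nat_rect T x0 (fun n x => projT1 (cid (rT n x)))); split=> // n /=.
exact: projT2 (cid _).
Qed.

(* The augmented complex 0 -> M -> E 0 -> E 1 -> ... *)
Definition aug_obj (M : lmodType R) (E : injective_resolution M) (n : nat) :
  lmodType R := if n is n'.+1 then E n' else M.

Definition aug_d (M : lmodType R) (E : injective_resolution M) (n : nat) :
  {linear aug_obj E n -> aug_obj E n.+1} :=
  match n with 0 => ires_aug E | n'.+1 => ires_d E n' end.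

Lemma aug_exact (M : lmodType R) (E : injective_resolution M) n
    (x : aug_obj E n.+1) :
  aug_d E n.+1 x = 0 <-> exists y, aug_d E n y = x.
Proof. by case: n x => [|n] x; [apply: ires_exact0 | apply: ires_exactS]. Qed.

Variables (M N : lmodType R).
Variables (E : injective_resolution M) (E' : injective_resolution N).

Lemma aug_dd n x : aug_d E' n.+1 (aug_d E' n x) = 0.
Proof. by apply/aug_exact; exists x. Qed.

Lemma chain_lift_exists (f : {linear M -> N}) :
  exists phi, chain_lift f (E := E) (E' := E') phi.
Proof.
pose T n := {p : {linear aug_obj E n -> aug_obj E' n} |
  forall x, aug_d E n x = 0 -> aug_d E' n (p x) = 0}.
pose r n (p : T n) (q : T n.+1) :=
  forall x, sval q (aug_d E n x) = aug_d E' n (sval p x).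
have rT n p : exists q, r n p q.
  case: p => p pP.
  have [k kE] := injective_extend (v := aug_d E n)
    (h := aug_d E' n \o p : {linear _ -> _}) (@ires_injective _ _ E' n) pP.
  have kP x : aug_d E n.+1 x = 0 -> aug_d E' n.+1 (k x) = 0.
    by move=> /aug_exact[y <-]; rewrite kE aug_dd.
  by exists (exist _ k kP).
have f0 x : aug_d E 0 x = 0 -> aug_d E' 0 (f x) = 0.
  move=> /= x0; suff -> : x = 0 by rewrite !linear0.
  by apply: (@ires_aug_inj _ _ E); rewrite x0 linear0.
have [s [s0 sr]] := dependent_choice rT (exist _ f f0 : T 0).
exists (fun n => sval (s n.+1)); split=> [m|n x]; last exact: (sr n.+1).
by rewrite (sr 0 m) s0.
Qed.

Lemma null_homotopy (phi : forall n, {linear E n -> E' n}) :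
  chain_lift (\0 : {linear M -> N}) phi ->
  exists s : forall n, {linear E n.+1 -> E' n},
    (forall x, phi 0 x = s 0 (ires_d E 0 x)) /\
    (forall n x, phi n.+1 x = ires_d E' n (s n x) + s n.+1 (ires_d E n.+1 x)).
Proof.
move=> [phi0 phiS].
pose P n : {linear aug_obj E n -> aug_obj E' n} :=
  if n is n'.+1 then phi n' else (\0 : {linear M -> N}).
have Pd n x : P n.+1 (aug_d E n x) = aug_d E' n (P n x).
  by case: n x => [|n] x; [exact: phi0 | exact: phiS].
pose T n := {p : {linear aug_obj E n.+1 -> aug_obj E' n} |
  forall x, P n.+1 (aug_d E n x) = aug_d E' n (p (aug_d E n x))}.
pose r n (p : T n) (q : T n.+1) := forall x,
  P n.+1 x = aug_d E' n (sval p x) + sval q (aug_d E n.+1 x).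
have rT n p : exists q, r n p q.
  case: p => p pP.
  pose h : {linear aug_obj E n.+1 -> aug_obj E' n.+1} :=
    P n.+1 \- (aug_d E' n \o p).
  have hP x : aug_d E n.+1 x = 0 -> h x = 0.
    by move=> /aug_exact[y <-]; rewrite /h /= pP subrr.
  have [k kE] := injective_extend (@ires_injective _ _ E' n) hP.
  have kP x : P n.+2 (aug_d E n.+1 x) = aug_d E' n.+1 (k (aug_d E n.+1 x)).
    by rewrite Pd kE /h /= linearB aug_dd subr0.
  by exists (exist _ k kP) => x; rewrite /= kE /h /= addrC subrK.
have z0 x : P 1 (aug_d E 0 x) = aug_d E' 0 ((\0 : {linear E 0 -> N}) (aug_d E 0 x)).
  by rewrite Pd /= !linear0.
have [s [s0 sr]] := dependent_choice rT (exist _ (\0 : {linear E 0 -> N}) z0 : T 0).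
exists (fun n => sval (s n.+1)); split=> [x|n x]; last exact: (sr n.+1).
by rewrite (sr 0 x) s0 /= linear0 add0r.
Qed.

End Comparison.

Section Cohomology.
Variables (R : pzRingType) (F : add_functor R).

Section Objects.
Variables (M : lmodType R) (E : injective_resolution M) (n : nat).

Definition cocycle_pred : F (E n) -> bool :=
  fun x => fmap F (ires_d E n) x == 0.

Fact cocycle_closed : zmod_closed (cocycle_pred : {pred F (E n)}).
Proof.
split=> [|x y]; rewrite !unfold_in /cocycle_pred ?raddf0 // => /eqP x0 /eqP y0.
by rewrite raddfB x0 y0 subrr.
Qed.

Definition cocycle := subgroup (zmod_closed_pack cocycle_closed).
HB.instance Definition _ := GRing.Zmodule.on cocycle.
End Objects.

Section Coboundaries.
Variables (M : lmodType R) (E : injective_resolution M).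

Definition coboundary_pred (n : nat) : cocycle E n -> bool :=
  match n with
  | 0 => fun z => val z == 0
  | n'.+1 => fun z =>
      `[< exists y : F (E n'), val z = fmap F (ires_d E n') y >]
  end.

Fact coboundary_closed n : zmod_closed (@coboundary_pred n : {pred _}).
Proof.
case: n => [|n]; split=> [|x y]; rewrite !unfold_in //=.
- by move=> /eqP x0 /eqP y0; rewrite x0 y0 subrr.
- by apply/asboolP; exists 0; rewrite raddf0.
- move=> /asboolP[u ux] /asboolP[v vy]; apply/asboolP; exists (u - v).
  by rewrite /= ux vy raddfB.
Qed.

Definition cohomology (n : nat) :=
  Quotient.quot (zmod_closed_pack (@coboundary_closed n)).
HB.instance Definition _ n := GRing.Zmodule.on (cohomology n).

Definition cohomology_class n (z : cocycle E n) : cohomology n := \pi z.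

Lemma cohomology_class_surj n (u : cohomology n) :
  exists z, u = cohomology_class z.
Proof. by exists (repr u); rewrite /cohomology_class reprK. Qed.

Lemma cohomology_classB n : {morph @cohomology_class n : x y / x - y}.
Proof. exact: raddfB. Qed.

Lemma cohomology_classD n : {morph @cohomology_class n : x y / x + y}.
Proof. exact: raddfD. Qed.

Lemma eq_cohomology_class n (x y : cocycle E n) :
  coboundary_pred (x - y) -> cohomology_class x = cohomology_class y.
Proof.
by move=> xy; apply/eqP; rewrite -subr_eq0 -cohomology_classB; rewrite pi_quot_eq0.
Qed.

End Coboundaries.

Section Map.
Variables (M N : lmodType R).
Variables (E : injective_resolution M) (E' : injective_resolution N).
Variables (f : {linear M -> N}) (phi : forall n, {linear E n -> E' n}).
Hypothesis phiP : chain_lift f phi.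

Lemma fmap_chain n x :
  fmap F (phi n.+1) (fmap F (ires_d E n) x) =
  fmap F (ires_d E' n) (fmap F (phi n) x).
Proof.
have := fmap_comp F (phi n.+1) (ires_d E n) x; rewrite /= => <-.
have := fmap_comp F (ires_d E' n) (phi n) x; rewrite /= => <-.
by apply: fmap_ext => y /=; rewrite phiP.2.
Qed.

Fact cocycle_map_subproof n x :
  x \in zmod_closed_pack (@cocycle_closed _ E n) ->
  fmap F (phi n) x \in zmod_closed_pack (@cocycle_closed _ E' n).
Proof.
move=> /eqP x0; apply/eqP.
by rewrite -fmap_chain x0 raddf0.
Qed.

Definition cocycle_map n : {additive cocycle E n -> cocycle E' n} :=
  sg_map (@cocycle_map_subproof n).

Fact cohomology_map_subproof n z :
  z \in zmod_closed_pack (@coboundary_closed _ E n) ->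
  cocycle_map n z \in zmod_closed_pack (@coboundary_closed _ E' n).
Proof.
case: n z => [|n] z.
  by move=> /eqP z0; apply/eqP; rewrite /= z0 raddf0.
move=> /asboolP[y zy]; apply/asboolP; exists (fmap F (phi n) y).
by rewrite -fmap_chain -zy.
Qed.

Definition cohomology_map n : {additive cohomology E n -> cohomology E' n} :=
  quot_map (@cohomology_map_subproof n).

Lemma cohomology_mapE n z :
  cohomology_map n (cohomology_class z) = cohomology_class (cocycle_map n z).
Proof. exact: quot_map_pi. Qed.

End Map.

Lemma cohomology_map_ext (M N : lmodType R)
    (E : injective_resolution M) (E' : injective_resolution N)
    (f g : {linear M -> N}) (phi psi : forall n, {linear E n -> E' n})
    (phiP : chain_lift f phi) (psiP : chain_lift g psi) :
  f =1 g -> forall n, cohomology_map phiP n =1 cohomology_map psiP n.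
Proof.
move=> fg n u; have [z ->] := cohomology_class_surj u.
rewrite !cohomology_mapE; apply: eq_cohomology_class.
pose d k : {linear E k -> E' k} := phi k \- psi k.
have dP : chain_lift (\0 : {linear M -> N}) d.
  split=> [m|k x]; rewrite /d /=.
    by rewrite phiP.1 psiP.1 fg linear0 subrr.
  by rewrite phiP.2 psiP.2 linearB.
have [s [s0 sS]] := null_homotopy dP.
have dE k x : fmap F (d k) x = fmap F (phi k) x - fmap F (psi k) x.
  exact: fmapB.
case: n z {u} => [|n] z.
  apply/eqP; rewrite /= -dE (fmap_ext F _ (s 0 \o ires_d E 0) s0).
  rewrite fmap_comp /=; have /eqP -> := sg_valP z; exact: raddf0.
apply/asboolP; exists (fmap F (s n) (val z)).
rewrite /= -dE (fmap_ext F _ ((ires_d E' n \o s n) \+ (s n.+1 \o ires_d E n.+1))).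
  rewrite fmapD /= !fmap_comp /=; have /eqP -> := sg_valP z.
  by rewrite raddf0 addr0.
exact: sS.
Qed.

End Cohomology.

Section RightDerived.
Variables (R : pzRingType).
Variable res : forall M : lmodType R, injective_resolution M.

Definition res_lift (M N : lmodType R) (f : {linear M -> N}) :
    forall n, {linear res M n -> res N n} :=
  projT1 (cid (chain_lift_exists (res M) (res N) f)).

Lemma res_liftP (M N : lmodType R) (f : {linear M -> N}) :
  chain_lift f (res_lift f).
Proof. exact: projT2 (cid _). Qed.

Variable F : add_functor R.

Definition right_derived_nat (n : nat) : add_functor R.
Proof.
exists (fun M => cohomology F (res M) n)
  (fun M N f => cohomology_map F (res_liftP f) n
     : {additive cohomology F (res M) n -> cohomology F (res N) n}).
- by move=> M N f g fg x; apply: cohomology_map_ext.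
- move=> M x.
  have idP : chain_lift (idfun : {linear M -> M})
    (fun n => idfun : {linear res M n -> res M n}) by [].
  rewrite (cohomology_map_ext (res_liftP _) idP) //.
  have [z ->] := cohomology_class_surj x; rewrite cohomology_mapE.
  by congr (cohomology_class _); apply: val_inj; rewrite /= fmap_id.
- move=> M N P g f x.
  have gfP : chain_lift (g \o f : {linear M -> P})
    (fun n => res_lift g n \o res_lift f n : {linear res M n -> res P n}).
    by split=> [m|k y] /=; rewrite ?(res_liftP f).1 ?(res_liftP g).1
                                   ?(res_liftP f).2 ?(res_liftP g).2.
  rewrite (cohomology_map_ext (res_liftP _) gfP) //.
  have [z ->] := cohomology_class_surj x; rewrite /comp.
  rewrite (cohomology_mapE gfP) (cohomology_mapE (res_liftP f)).
  rewrite (cohomology_mapE (res_liftP g)).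
  congr (cohomology_class _); apply: val_inj; exact: fmap_comp.
- move=> M N f g x.
  have fgP : chain_lift (f \+ g : {linear M -> N})
    (fun n => res_lift f n \+ res_lift g n : {linear res M n -> res N n}).
    split=> [m|k y] /=.
      by rewrite (res_liftP f).1 (res_liftP g).1 linearD.
    by rewrite (res_liftP f).2 (res_liftP g).2 linearD.
  rewrite (cohomology_map_ext (res_liftP _) fgP) //.
  have [z ->] := cohomology_class_surj x.
  rewrite [RHS]/(cohomology_map _ _ _ _ + cohomology_map _ _ _ _).
  rewrite (cohomology_mapE fgP) (cohomology_mapE (res_liftP f)).
  rewrite (cohomology_mapE (res_liftP g)).
  apply: etrans (cohomology_classD _ _).
  congr (cohomology_class _); apply: val_inj; exact: fmapD.
Defined.

Definition right_derived (i : int) : add_functor R :=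
  if i is Posz n then right_derived_nat n else zero_functor R.

Fact to_R0_subproof (M : lmodType R) (x : F M) :
  fmap F (ires_aug (res M)) x
    \in zmod_closed_pack (@cocycle_closed _ F _ (res M) 0).
Proof.
apply/eqP; have := fmap_comp F (ires_d (res M) 0) (ires_aug (res M)) x.
move=> /= <-; apply: fmap0 => y /=; apply/ires_exact0.
by exists y.
Qed.

Definition to_R0_fun (M : lmodType R) (x : F M) : right_derived 0 M :=
  cohomology_class (Subgroup (to_R0_subproof x) : cocycle F (res M) 0).

Fact to_R0_zmod_morphism (M : lmodType R) : zmod_morphism (@to_R0_fun M).
Proof.
move=> x y; rewrite /to_R0_fun -cohomology_classB.
by congr (cohomology_class _); apply: val_inj; rewrite /= raddfB.
Qed.

HB.instance Definition _ (M : lmodType R) :=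
  GRing.isZmodMorphism.Build _ _ (@to_R0_fun M) (@to_R0_zmod_morphism M).

Definition to_R0 : nat_trans F (right_derived 0).
Proof.
exists (fun M => @to_R0_fun M : {additive F M -> right_derived 0 M}).
move=> M N f x; apply/esym; apply: (etrans (cohomology_mapE (res_liftP f)
  (Subgroup (to_R0_subproof x) : cocycle F (res M) 0))).
congr (cohomology_class _); apply: val_inj => /=.
have := fmap_comp F (res_lift f 0) (ires_aug (res M)) x; rewrite /= => <-.
have := fmap_comp F (ires_aug (res N)) f x; rewrite /= => <-.
by apply: fmap_ext => y /=; rewrite (res_liftP f).1.
Defined.

End RightDerived.

(* Ext is computed from injective resolutions of the second argument *)
Definition Ext (R : pzRingType)
    (res : forall M : lmodType R, injective_resolution M) (i : int)
    (Q : lmodType R) : add_functor R :=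
  right_derived res (hom_functor Q) i.

(* Main.v *)
(** A natural transformation that is bijective on injective modules induces
isomorphisms on all right derived functors, and R^0 Hom(Q, _) = Hom(Q, _), so
it suffices that kappa is bijective on injective right modules E.  Injectivity
is clear; surjectivity says that an element e of E killed by the trace of the
injectives in L satisfies e (x) iota 1 = 0.  As I is injective, one may replace
iota by any map j from L to a finitely presented injective J.  Writing J as the
cokernel of a matrix K, e (x) j 1 vanishes iff a linear system with matrix K is
solvable in E, hence iff it is consistent, and the consistency conditions are
equations e * g (j 1) = 0 with g : J -> L. *)

Require Import Defs.
From HB Require Import structures.
From mathcomp Require Import all_boot all_order all_algebra.
From mathcomp Require Import boolp.

Set Implicit Arguments.
Unset Strict Implicit.
Unset Printing Implicit Defensive.

Import GRing.Theory.
Local Open Scope ring_scope.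

(** * Bijectivity criteria and sums of tensors *)

Lemma inj_surj_bij (A B : Type) (f : A -> B) :
  injective f -> (forall y, exists x, f x = y) -> bijective f.
Proof.
move=> f_inj f_surj; have fK y := projT2 (cid (f_surj y)).
by exists (fun y => projT1 (cid (f_surj y))) => // x; apply: f_inj; apply: fK.
Qed.

Lemma additive_inj (V W : zmodType) (f : {additive V -> W}) :
  (forall x, f x = 0 -> x = 0) -> injective f.
Proof.
move=> f0 x y fxy; apply/eqP; rewrite -subr_eq0; apply/eqP/f0.
by rewrite raddfB fxy subrr.
Qed.

Lemma tens0 (L : pzRingType) (M : rmodType L) (N : lmodType L) (m : M) :
  tens m (0 : N) = 0.
Proof.
have [_ tDr _] := tens_balanced M N.
by apply: (addrI (tens m 0)); rewrite -tDr !addr0.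
Qed.

Lemma tens_sumr (L : pzRingType) (M : rmodType L) (N : lmodType L) (m : M)
    (T : Type) (r : seq T) (F : T -> N) :
  tens m (\sum_(i <- r) F i) = \sum_(i <- r) tens m (F i).
Proof.
have [_ tDr _] := tens_balanced M N.
exact: (big_morph (tens m) (tDr m) (tens0 _ _)).
Qed.

Lemma tens_suml (L : pzRingType) (M : rmodType L) (N : lmodType L) (n : N)
    (T : Type) (r : seq T) (F : T -> M) :
  tens (\sum_(i <- r) F i) n = \sum_(i <- r) tens (F i) n.
Proof.
have [tDl _ _] := tens_balanced M N.
have t0 : tens (0 : M) n = 0 by apply: (addrI (tens 0 n)); rewrite -tDl !addr0.
exact: (big_morph (fun x => tens x n) (fun x y => tDl x y n) t0).
Qed.

(** * Finite presentations and linear systems over an injective module *)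

Section Presentation.
Variables (L : pzRingType) (m n : nat) (J : lmodType L).
Variables (p : {linear 'rV[L]_n -> J}) (k : {linear 'rV[L]_m -> 'rV[L]_n}).
Hypothesis p_surj : forall x, exists u, p u = x.
Hypothesis p_ker : forall u, p u = 0 <-> exists v, k v = u.

(** Multiplication by [c] vanishes on the image of [k], which is the kernel of [p], so it descends
    to [J]; the section [s] below need not be linear. *)
Lemma presentation_hom (c : 'cV[L]_n) :
  (forall v, k v *m c = 0) ->
  exists g : {linear J -> L^o}, forall u, g (p u) = (u *m c) 0 0.
Proof.
move=> kc.
pose s x := projT1 (cid (p_surj x)).
have sK x : p (s x) = x := projT2 (cid (p_surj x)).
have cE u u' : p u = p u' -> u *m c = u' *m c.
  move=> puu'; apply/eqP; rewrite -subr_eq0 -mulmxBl; apply/eqP.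
  have /p_ker[v <-] : p (u - u') = 0 by rewrite linearB puu' subrr.
  exact: kc.
pose g (x : J) : L^o := (s x *m c) 0 0.
have gL : linear g.
  move=> a x y; rewrite /g (cE _ (a *: s x + s y)) ?linearP ?sK //.
  by rewrite mulmxDl -scalemxAl !mxE.
exists (HB.pack_for {linear J -> L^o} g (GRing.isLinear.Build _ _ _ _ g gL)).
by move=> u; rewrite /= /g (cE _ u) ?sK.
Qed.

(** With p_j the image under [p] of the j-th basis row, it suffices to find X_i in [E] with e u_j =
    sum_i X_i K_ij for all j: then e (x) p u = sum_i X_i (x) sum_j K_ij p_j, and each inner sum is p
    (k (delta_i)) = 0. *)
Lemma tens_presentation_eq0 (E : rmodType L) (e : E) (u : 'rV[L]_n) :
  injective_module E ->
  (forall c : 'cV[L]_n, (forall v, k v *m c = 0) ->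
     ((u *m c) 0 0 : L^c) *: e = 0) ->
  tens e (p u) = 0.
Proof.
move=> E_inj ue; have [_ _ tZ] := tens_balanced E J.
pose K i j : L := k (delta_mx 0 i) 0 j.
(* Columns over [L] become rows over [L^c], where products are reversed: right multiplication by the
   transpose [KT] is c |-> K c. *)
pose KT : 'M[L^c]_(n, m) := \matrix_(j, i) K i j.
pose h (c : 'rV[L^c]_n) : E := ((\sum_j u 0 j * c 0 j : L) : L^c) *: e.
have hL : linear h.
  move=> a c d; rewrite /h scalerA -scalerDl; congr (_ *: e).
  rewrite [a * _]mulr_suml -big_split /=; apply: eq_bigr => j _.
  by rewrite !mxE mulrDr -mulrA.
pose hM : {linear 'rV[L^c]_n -> E} :=
  HB.pack_for {linear 'rV[L^c]_n -> E} h (GRing.isLinear.Build _ _ _ _ h hL).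
have kE v j : k v 0 j = \sum_i v 0 i * K i j.
  rewrite {1}[v]row_sum_delta linear_sum summxE.
  by apply: eq_bigr => i _; rewrite linearZ mxE.
(* Consistency of the system: since k v = v K, the equation K c = 0 makes [ue] applicable to [c]. *)
have hK c : mulmxr KT c = 0 -> hM c = 0.
  move=> /rowP cK; rewrite /= /h.
  have := ue (\col_j c 0 j); rewrite mxE.
  under eq_bigr do rewrite mxE; apply=> v; apply/matrixP=> i j.
  rewrite !ord1 !mxE; under eq_bigr do rewrite mxE kE mulr_suml.
  rewrite exchange_big big1 // => l _.
  under eq_bigr do rewrite -mulrA.
  rewrite -mulr_sumr; have := cK l; rewrite !mxE => cKl.
  under eq_bigr => j' _.
    have -> : K l j' * c 0 j' = (c 0 j' * KT j' l : L^c) by rewrite mxE.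
    over.
  by rewrite cKl mulr0.
(* Injectivity of [E] extends K c |-> e (u c) to all rows; the values on the basis solve the
   system. *)
have [x xE] := injective_extend E_inj hK.
rewrite [u]row_sum_delta linear_sum tens_sumr.
pose X i : E := x (delta_mx 0 i).
have Xe j : (u 0 j : L^c) *: e = \sum_i (K i j : L^c) *: X i.
  have := xE (delta_mx 0 j).
  rewrite /= /h (bigD1 j) //= big1 ?mxE ?eqxx ?addr0; last first.
    by move=> l lj; rewrite mxE (negPf lj) andbF mulr0.
  rewrite mulr1 => <-.
  rewrite [_ *m _]row_sum_delta linear_sum; apply: eq_bigr => i _.
  by rewrite linearZ -rowE !mxE.
under eq_bigr => j _ do rewrite linearZ -tZ Xe tens_suml.
rewrite exchange_big big1 //= => i _.
under eq_bigr => j _ do rewrite tZ.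
rewrite -tens_sumr -[RHS](tens0 J (X i)); congr tens.
transitivity (p (k (delta_mx 0 i))); last by apply/p_ker; exists (delta_mx 0 i).
rewrite [k _]row_sum_delta linear_sum; apply: eq_bigr => j _.
by rewrite linearZ.
Qed.

End Presentation.

(** * Bijectivity of [kappa] on injective modules *)

Section KappaInjective.
Variables (L : pzRingType) (I : lmodType L) (iota : {linear L^o -> I}).
Hypothesis iota_env : injective_envelope iota.

(** The value of [kappa] at the class of 1 recovers the torsion element. *)
Lemma kappa_inj (M : rmodType L) : injective (kappa iota_env M).
Proof.
apply: additive_inj => x x0; apply: val_inj.
rewrite -[LHS](scale1r (sg_val x)).
have := kappa_funE iota_env x (1 : L^c).
by rewrite -[kappa_fun _ _]/(kappa iota_env M x) x0 => <-.
Qed.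

Lemma tens_finitely_presented_eq0 (E : rmodType L) (e : E)
    (J : lmodType L) (j : {linear L^o -> J}) :
  injective_module E -> injective_module J -> finitely_presented J ->
  (forall c : L, factors_injective (c : L^o) -> (c : L^c) *: e = 0) ->
  tens e (j 1) = 0.
Proof.
move=> E_inj J_inj [n [m [p [k [p_surj p_ker]]]]] ce.
have [u uj] := p_surj (j 1); rewrite -uj.
apply: (tens_presentation_eq0 p_ker E_inj) => c kc; apply: ce.
have [g gE] := presentation_hom p_surj p_ker kc.
(* The scalar u c equals g (j 1), so it belongs to the trace by way of [J] itself. *)
exists J, j, g; split=> // a.
have -> : j a = a *: j 1 by rewrite -linearZ; congr (j _); rewrite /= [RHS]mulr1.
by rewrite linearZ -uj gE.
Qed.

Hypothesis L_FPE : left_FPE L.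

(** The finitely presented envelope [J] given by [left_FPE] may differ from [I]; extending [iota]
    along [j] to f : J -> I carries e (x) j 1 = 0 to e (x) iota 1 = 0. *)
Lemma torsion_injective (E : rmodType L) (e : E) :
  injective_module E ->
  (forall c : L, factors_injective (c : L^o) -> (c : L^c) *: e = 0) ->
  e \in zmod_closed_pack (@torsion_closed L I iota E).
Proof.
move=> E_inj ce; have [I_inj _ _] := iota_env.
have [J [j [[J_inj j_inj _] J_fp]]] := L_FPE.
have [f fE] := I_inj _ _ j iota j_inj.
have := tensor_map_tens (idfun : {linear E -> E}) f e (j 1).
rewrite (tens_finitely_presented_eq0 j E_inj J_inj J_fp ce) raddf0 fE => /esym ei.
by rewrite torsionE ei.
Qed.

Lemma kappa_injective_bij (E : rmodType L) :
  injective_module E -> bijective (kappa iota_env E).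
Proof.
move=> E_inj; apply: inj_surj_bij => [|h]; first exact: kappa_inj.
(* The right module q(L) is generated by the class of 1, so [h] is determined by [e], and [e] is
   killed by the trace because [h] is defined on the quotient. *)
pose e : E := h (pi_mod _ (1 : (L^c)^o)).
have hE (a : L^c) : h (pi_mod _ (a : (L^c)^o)) = a *: e.
  rewrite /e -linearZ; congr (h _); rewrite -linearZ; congr pi_mod.
  by rewrite [RHS]mulr1.
have eP : e \in zmod_closed_pack (@torsion_closed L I iota E).
  apply: torsion_injective => // c c_fac; rewrite -(hE c).
  rewrite -[RHS](linear0 h); congr (h _); apply/eqP; rewrite pi_mod_eq0.
  exact/asboolP.
exists (Subgroup eP); apply: linear_ext => v; have [a ->] := pi_mod_surj v.
by rewrite hE; apply: kappa_funE.
Qed.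

End KappaInjective.

(** * Composition and inversion of natural transformations *)

Definition nat_comp (R : pzRingType) (F G H : add_functor R)
    (t : nat_trans G H) (s : nat_trans F G) : nat_trans F H.
Proof.
exists (fun M => t M \o s M : {additive F M -> H M}) => M N f x /=.
by rewrite !ncomp_nat.
Defined.

Lemma nat_iso_inv (R : pzRingType) (F G : add_functor R) (t : nat_trans F G) :
  is_nat_iso t ->
  exists s : nat_trans G F, forall M, cancel (t M) (s M) /\ cancel (s M) (t M).
Proof.
move=> t_iso.
have tV M : exists g, cancel (t M) g /\ cancel g (t M).
  by case: (t_iso M) => g; exists g.
pose g M := projT1 (cid (tV M)).
have [tK gK] : (forall M, cancel (t M) (g M)) /\ (forall M, cancel (g M) (t M)).
  by split=> M; have [] := projT2 (cid (tV M)).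
have gB M : zmod_morphism (g M).
  by move=> x y; apply: (can_inj (tK M)); rewrite raddfB !gK.
pose gA M : {additive G M -> F M} := HB.pack_for {additive G M -> F M} (g M)
  (GRing.isZmodMorphism.Build _ _ (g M) (gB M)).
have gN (M N : lmodType R) (f : {linear M -> N}) x : gA N (fmap G f x) = fmap F f (gA M x).
  by apply: (can_inj (tK N)); rewrite ncomp_nat /= !gK.
by exists (NatTrans gN) => M; split; [apply: tK | apply: gK].
Qed.

(** * Transformations induced on derived functors *)

Section DerivedTransformation.
Variables (R : pzRingType) (F G : add_functor R) (t : nat_trans F G).

Section Resolution.
Variables (M : lmodType R) (E : injective_resolution M) (n : nat).

Fact cocycle_trans_subproof x :
  x \in zmod_closed_pack (@cocycle_closed _ F _ E n) ->
  t (E n) x \in zmod_closed_pack (@cocycle_closed _ G _ E n).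
Proof. by move=> /eqP x0; apply/eqP; rewrite -ncomp_nat x0 raddf0. Qed.

Definition cocycle_trans : {additive cocycle F E n -> cocycle G E n} :=
  sg_map cocycle_trans_subproof.

End Resolution.

Fact cohomology_trans_subproof (M : lmodType R) (E : injective_resolution M) n z :
  z \in zmod_closed_pack (@coboundary_closed _ F _ E n) ->
  cocycle_trans E n z \in zmod_closed_pack (@coboundary_closed _ G _ E n).
Proof.
case: n z => [|n] z.
  by move=> /eqP z0; apply/eqP; rewrite /= z0 raddf0.
move=> /asboolP[y zy]; apply/asboolP; exists (t _ y).
by rewrite -ncomp_nat -zy.
Qed.

Definition cohomology_trans (M : lmodType R) (E : injective_resolution M) n :
    {additive cohomology F E n -> cohomology G E n} :=
  quot_map (@cohomology_trans_subproof M E n).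

Lemma cohomology_transE (M : lmodType R) (E : injective_resolution M) n z :
  cohomology_trans E n (cohomology_class z) =
  cohomology_class (cocycle_trans E n z).
Proof. exact: quot_map_pi. Qed.

Variable res : forall M : lmodType R, injective_resolution M.

Definition derived_trans_nat (n : nat) :
  nat_trans (right_derived_nat res F n) (right_derived_nat res G n).
Proof.
exists (fun M => cohomology_trans (res M) n) => M N f x.
have [z ->] := cohomology_class_surj x.
(* Both composites use the same lift of [f], so they already agree on cocycles by naturality of
   [t]. *)
transitivity (cohomology_class (cocycle_trans (res N) n
    (cocycle_map F (res_liftP res f) n z))).
  apply: etrans (cohomology_transE _).
  exact: (congr1 (cohomology_trans (res N) n) (cohomology_mapE _ _)).
transitivity (cohomology_class (cocycle_map G (res_liftP res f) n
    (cocycle_trans (res M) n z))); last first.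
  apply: etrans (esym (cohomology_mapE _ _)) _.
  exact/esym/(congr1 (cohomology_map G (res_liftP res f) n))/cohomology_transE.
by congr cohomology_class; apply: val_inj; apply: ncomp_nat.
Defined.

(** Naturality in F of F -> R^0 F; this is what later matches [kappa] with the canonical
    transformation. *)
Lemma derived_trans_to_R0 (M : lmodType R) (x : F M) :
  derived_trans_nat 0 M (to_R0 res F M x) = to_R0 res G M (t M x).
Proof.
apply: etrans (cohomology_transE _) _.
by congr cohomology_class; apply: val_inj; apply: ncomp_nat.
Qed.

Hypothesis t_bij : forall J : lmodType R, injective_module J -> bijective (t J).

(** All terms of the resolution are injective, so [t] is an isomorphism between the complexes F(E)
    and G(E). *)
Lemma derived_trans_nat_iso n : is_nat_iso (derived_trans_nat n).
Proof.
move=> M; set E := res M.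
have tE_bij k : bijective (t (E k)) := t_bij (@ires_injective _ _ E k).
have tE_inj k := bij_inj (tE_bij k).
have tE_surj k y : exists x, t (E k) x = y.
  by case: (tE_bij k) => g _ gK; exists (g y).
apply: inj_surj_bij => [|y].
  apply: additive_inj => x; have [z ->] := cohomology_class_surj x.
  move=> /(etrans (esym (cohomology_transE z)))/eqP.
  rewrite /cohomology_class pi_quot_eq0 => tz. apply/eqP; rewrite pi_quot_eq0.
  (* In degree 0 only zero is a coboundary; in positive degree a primitive is pulled back along
     [t]. *)
  case: n z tz {x} => [|n] z.
    by move=> /eqP tz; apply/eqP; apply: (tE_inj 0); rewrite raddf0.
  move=> /asboolP[y tz]; apply/asboolP; have [x xy] := tE_surj n y.
  by exists x; apply: (tE_inj n.+1); rewrite ncomp_nat xy.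
have [[w wP] ->] := cohomology_class_surj y; have [x xw] := tE_surj n w.
have xP : x \in zmod_closed_pack (@cocycle_closed _ F _ E n).
  apply/eqP; apply: (tE_inj n.+1); rewrite ncomp_nat xw raddf0.
  exact/eqP.
exists (cohomology_class (Subgroup xP : cocycle F E n)).
apply: etrans (cohomology_transE _) _.
by congr cohomology_class; apply: val_inj.
Qed.

End DerivedTransformation.

(** * The zeroth derived functor of Hom, and the conclusion *)

Lemma to_R0_hom_iso (R : pzRingType) (Q : lmodType R)
    (res : forall M : lmodType R, injective_resolution M) :
  is_nat_iso (to_R0 res (hom_functor Q)).
Proof.
move=> M; set E := res M; apply: inj_surj_bij => [|y].
  apply: additive_inj => h /eqP.
  rewrite /= /to_R0_fun /cohomology_class pi_quot_eq0 => /eqP /= h0.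
  apply: linear_ext => q; apply: (@ires_aug_inj _ _ E); rewrite raddf0.
  exact: (congr1 (fun k : linhom Q (E 0) => k q) h0).
have [[w wP] ->] := cohomology_class_surj y.
have w0 q : ires_d E 0 (w q) = 0.
  by have /eqP w0 := wP; exact: (congr1 (fun k : linhom Q (E 1) => k q) w0).
(* Left exactness of Hom: a cocycle [w] takes values in the image of the augmentation and hence
   factors through [M]. *)
have aug_w q : exists m, ires_aug E m = w q by apply/ires_exact0.
pose h q := projT1 (cid (aug_w q)).
have hE q : ires_aug E (h q) = w q := projT2 (cid (aug_w q)).
have hL : linear h.
  by move=> a x z; apply: (@ires_aug_inj _ _ E); rewrite linearP !hE linearP.
exists (HB.pack_for {linear Q -> M} h (GRing.isLinear.Build _ _ _ _ h hL)).
rewrite /= /to_R0_fun; congr cohomology_class; apply: val_inj.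
by apply: linear_ext => q; apply: hE.
Qed.

Theorem theorem5p2 (L : pzRingType) (L_FPE : left_FPE L)
    (I : lmodType L) (iota : {linear L^o -> I})
    (iota_env : injective_envelope iota)
    (res : forall M : rmodType L, injective_resolution M) :
  (exists theta : nat_trans (right_derived res (torsion_functor iota) 0)
                            (hom_functor (cotorsion L)),
     is_nat_iso theta /\
     forall (M : rmodType L) (m : torsion_functor iota M),
       theta M (to_R0 res (torsion_functor iota) M m) = kappa iota_env M m) /\
  (forall i : int,
     exists theta : nat_trans (right_derived res (torsion_functor iota) i)
                              (Ext res i (cotorsion L)),
       is_nat_iso theta).
Proof.
have kappa_bij := @kappa_injective_bij L I iota iota_env L_FPE.
have Rkappa_iso n := derived_trans_nat_iso res kappa_bij n.
split; last first.
  case=> n.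
    by exists (derived_trans_nat (kappa iota_env) res n); apply: Rkappa_iso.
  (* In negative degrees both sides are the zero functor. *)
  have idN (M N : lmodType L^c) (f : {linear M -> N}) x :
    (idfun : {additive zero_functor L^c N -> zero_functor L^c N})
      (fmap (zero_functor L^c) f x) = fmap (zero_functor L^c) f x by [].
  by exists (NatTrans idN) => M; exists id.
(* The isomorphism is R^0 [kappa] followed by the inverse [s] of Hom -> R^0 Hom; on the image of
   [to_R0], the map [s] cancels and leaves [kappa]. *)
have [s sK] := nat_iso_inv (@to_R0_hom_iso _ (cotorsion L) res).
exists (nat_comp s (derived_trans_nat (kappa iota_env) res 0)); split=> [M|M m].
  apply: (@bij_comp _ _ _ (s M)); last exact: Rkappa_iso.
  by exists (to_R0 res _ M); case: (sK M).
apply: etrans (congr1 (s M) (derived_trans_to_R0 _ _ m)) _.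
by have [] := sK M.
Qed.
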